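(* Let $\mathbb{Q}(i)$ be the quadratic field, where $i^2=-1$, and consider the quaternion algebra $\mathbb{H}_{\mathbb{Q}(i)}(-1,-2)$. For each positive integer $n$ let $F_{n,\sigma}$ be the $\sigma$-permutated $n$th Fibonacci-Hurwitz quaternion. If $\sigma$ is one of the four permutations $$\begin{pmatrix} n & n+1 & n+2 & n+3\\ n+3 & n & n+1 & n+2\end{pmatrix},\quad \begin{pmatrix} n & n+1 & n+2 & n+3\\ n & n+3 & n+1 & n+2\end{pmatrix},$$ $$\begin{pmatrix} n & n+1 & n+2 & n+3\\ n+3 & n & n+2 & n+1\end{pmatrix},\quad \begin{pmatrix} n & n+1 & n+2 & n+3\\ n & n+3 & n+2 & n+1\end{pmatrix},$$ then $\mathbf{n}(F_{n,\sigma})=f_{2n+3}$.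
   Context: $(f_n)_{n\ge0}$ is the Fibonacci sequence: $f_0=0$, $f_1=1$, $f_n=f_{n-1}+f_{n-2}$ for $n\ge2$. $\mathbb{H}_{\mathbb{Q}(i)}(-1,-2)$ is the 4-dimensional associative unital $\mathbb{Q}(i)$-algebra with basis $\{1,e_2,e_3,e_4\}$ and $e_2^2=-1$, $e_3^2=-2$, $e_2e_3=-e_3e_2=e_4$; the norm of $x=x_1+x_2e_2+x_3e_3+x_4e_4$ is $\mathbf{n}(x)=x_1^2+x_2^2+2x_3^2+2x_4^2$. For a positive integer $n$ and a permutation $\sigma$ of the set $\{n,n+1,n+2,n+3\}$, the $\sigma$-permutated $n$th Fibonacci-Hurwitz quaternion is $$F_{n,\sigma}=\tfrac12 f_{\sigma(n)}+\tfrac12 f_{\sigma(n+1)}e_2+\tfrac12 f_{\sigma(n+2)}e_3+\tfrac12 f_{\sigma(n+3)}e_4.$$ In the two-row notation for $\sigma$, each element of the top row is mapped to the element below it. *)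

(* Defs.v *)
From HB Require Import structures.
From mathcomp Require Import all_boot all_order all_fingroup all_algebra.
From mathcomp.real_closed Require Import complex.
From mathcomp Require Import ring.

Set Implicit Arguments.
Unset Strict Implicit.
Unset Printing Implicit Defensive.

Import GRing.Theory.
Local Open Scope ring_scope.

Fixpoint fib (n : nat) : nat :=
  match n with
  | 0 => 0
  | S p => match p with
           | 0 => 1
           | S q => fib p + fib q
           end
  end%N.

(* The quaternion algebra H_K(a, b), elements being given by their coordinates
   in the basis 1, e2, e3, e4.  The product qmul is the bilinear extension of
   e2^2 = a, e3^2 = b, e2 e3 = - e3 e2 = e4, so that
   e4^2 = - a b, e2 e4 = - e4 e2 = a e3, e4 e3 = - e3 e4 = b e2. *)
Record quat (K : fieldType) (a b : K) : Type :=
  Quat { q1 : K; q2 : K; q3 : K; q4 : K }.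

Section QuaternionAlgebra.
Variables (K : fieldType) (a b : K).
Local Notation H := (quat a b).

Definition quat_to_tuple (x : H) : K * K * K * K := (q1 x, q2 x, q3 x, q4 x).
Definition quat_of_tuple (t : K * K * K * K) : H :=
  Quat a b t.1.1.1 t.1.1.2 t.1.2 t.2.
Lemma quat_to_tupleK : cancel quat_to_tuple quat_of_tuple.
Proof. by case. Qed.
HB.instance Definition _ := Choice.copy H (can_type quat_to_tupleK).

Definition qadd (x y : H) : H :=
  Quat a b (q1 x + q1 y) (q2 x + q2 y) (q3 x + q3 y) (q4 x + q4 y).
Definition qopp (x : H) : H := Quat a b (- q1 x) (- q2 x) (- q3 x) (- q4 x).
Definition qzero : H := Quat a b 0 0 0 0.
Definition qone : H := Quat a b 1 0 0 0.
Definition qmul (x y : H) : H :=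
  Quat a b
    (q1 x * q1 y + a * (q2 x * q2 y) + b * (q3 x * q3 y)
       - a * b * (q4 x * q4 y))
    (q1 x * q2 y + q2 x * q1 y - b * (q3 x * q4 y) + b * (q4 x * q3 y))
    (q1 x * q3 y + q3 x * q1 y + a * (q2 x * q4 y) - a * (q4 x * q2 y))
    (q1 x * q4 y + q4 x * q1 y + q2 x * q3 y - q3 x * q2 y).
Definition qscale (k : K) (x : H) : H :=
  Quat a b (k * q1 x) (k * q2 x) (k * q3 x) (k * q4 x).

Local Ltac quat_ring :=
  repeat (let x := fresh "x" in intro x; try (case: x => ? ? ? ?));
  rewrite /qadd /qopp /qzero /qone /qmul /qscale /=; congr Quat; ring.

Fact qaddA : associative qadd. Proof. by quat_ring. Qed.
Fact qaddC : commutative qadd. Proof. by quat_ring. Qed.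
Fact qadd0 : left_id qzero qadd. Proof. by quat_ring. Qed.
Fact qaddN : left_inverse qzero qopp qadd. Proof. by quat_ring. Qed.
HB.instance Definition _ := GRing.isZmodule.Build H qaddA qaddC qadd0 qaddN.

Fact qmulA : associative qmul. Proof. by quat_ring. Qed.
Fact qmul1l : left_id qone qmul. Proof. by quat_ring. Qed.
Fact qmul1r : right_id qone qmul. Proof. by quat_ring. Qed.
Fact qmulDl : left_distributive qmul qadd. Proof. by quat_ring. Qed.
Fact qmulDr : right_distributive qmul qadd. Proof. by quat_ring. Qed.
Fact qone_neq0 : qone != 0 :> H.
Proof. by apply/eqP => -[/eqP]; rewrite oner_eq0. Qed.
HB.instance Definition _ := GRing.Zmodule_isNzRing.Build H
  qmulA qmul1l qmul1r qmulDl qmulDr qone_neq0.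

Fact qscaleA k l (x : H) : qscale k (qscale l x) = qscale (k * l) x.
Proof. by move: x; quat_ring. Qed.
Fact qscale1 : left_id 1 qscale. Proof. by quat_ring. Qed.
Fact qscaleDr : right_distributive qscale qadd.
Proof. by move=> k; quat_ring. Qed.
Fact qscaleDl x : {morph qscale^~ x : k l / k + l >-> qadd k l}.
Proof. by move=> k l; move: x; quat_ring. Qed.
HB.instance Definition _ := GRing.Zmodule_isLmodule.Build K H
  qscaleA qscale1 qscaleDr qscaleDl.

Fact qscaleAl (k : K) (x y : H) :
  qscale k (qmul x y) = qmul (qscale k x) y.
Proof. by move: x y; quat_ring. Qed.
HB.instance Definition _ := GRing.Lmodule_isLalgebra.Build K H qscaleAl.
Fact qscaleAr (k : K) (x y : H) :
  qscale k (qmul x y) = qmul x (qscale k y).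
Proof. by move: x y; quat_ring. Qed.
HB.instance Definition _ := GRing.Lalgebra_isAlgebra.Build K H qscaleAr.

Definition e2 : H := Quat a b 0 1 0 0.
Definition e3 : H := Quat a b 0 0 1 0.
Definition e4 : H := Quat a b 0 0 0 1.

Lemma e2_sqr : e2 ^+ 2 = a%:A.
Proof. by congr Quat => /=; ring. Qed.
Lemma e3_sqr : e3 ^+ 2 = b%:A.
Proof. by congr Quat => /=; ring. Qed.
Lemma e2e3 : e2 * e3 = e4.
Proof. by congr Quat => /=; ring. Qed.
Lemma e3e2 : e3 * e2 = - e4.
Proof. by congr Quat => /=; ring. Qed.

Lemma quat_coords (x1 x2 x3 x4 : K) :
  x1%:A + x2 *: e2 + x3 *: e3 + x4 *: e4 = Quat a b x1 x2 x3 x4.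
Proof. by congr Quat => /=; ring. Qed.

End QuaternionAlgebra.

(* rat[i] is the field Q(i), with elements u +i* v for u, v : rat. *)
Definition Qi : fieldType := rat[i]%C.

Definition HQi : algType Qi := quat (-1 : Qi) (-2 : Qi).

Definition qnorm (x : HQi) : Qi :=
  q1 x ^+ 2 + q2 x ^+ 2 + 2 * q3 x ^+ 2 + 2 * q4 x ^+ 2.

Definition qconj (x : HQi) : HQi := Quat _ _ (q1 x) (- q2 x) (- q3 x) (- q4 x).

Lemma mul_qconj (x : HQi) : x * qconj x = (qnorm x)%:A.
Proof.
case: x => x1 x2 x3 x4; rewrite /qconj /qnorm /=.
by congr Quat; rewrite /=; ring.
Qed.

(* The set {n, n+1, n+2, n+3}, as a finite type. *)
Definition window (n : nat) : finType := seq_sub (iota n 4).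

(* s as a function on nat; its value outside of the window is immaterial. *)
Definition wapp (n : nat) (s : {perm window n}) (k : nat) : nat :=
  if insub k is Some u then val (s u) else k.

(* s has the two-row notation with rows n, n+1, n+2, n+3 and bottom. *)
Definition two_row (n : nat) (s : {perm window n}) (bottom : seq nat) : Prop :=
  [seq wapp s k | k <- [:: n; n + 1; n + 2; n + 3]%N] = bottom.

Definition FibHurwitz (n : nat) (s : {perm window n}) : HQi :=
    (2^-1 * (fib (wapp s n))%:R) *: 1
  + (2^-1 * (fib (wapp s (n + 1)))%:R) *: e2 _ _
  + (2^-1 * (fib (wapp s (n + 2)))%:R) *: e3 _ _
  + (2^-1 * (fib (wapp s (n + 3)))%:R) *: e4 _ _.

(* Main.v *)
Require Import Defs.
From HB Require Import structures.
From mathcomp Require Import all_boot all_order all_fingroup all_algebra.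
From mathcomp Require Import ring.
Import GRing.Theory.
Local Open Scope ring_scope.

(** All four permutations send [n + 2] and [n + 3], the indices whose
    coordinates have weight 2 in the norm, to [n + 1] and [n + 2], and the two
    indices of weight 1 to [n] and [n + 3].  So each of the four norms equals
    (f_n^2 + f_{n+3}^2 + 2 f_{n+1}^2 + 2 f_{n+2}^2) / 4.
    As f_n = f_{n+2} - f_{n+1} and f_{n+3} = f_{n+2} + f_{n+1}, the
    parallelogram law gives
    f_n^2 + f_{n+3}^2 = 2 (f_{n+1}^2 + f_{n+2}^2), hence the norm is
    f_{n+1}^2 + f_{n+2}^2, which is f_{2n+3} by the case of equal indices of
    the addition formula [fib_addS]. *)

Lemma fibSS n : fib n.+2 = (fib n.+1 + fib n)%N.
Proof. by []. Qed.

(** Moving one unit from [m] to [n] fixes the left side, and by the recurrence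
    it fixes the right side too; at [m = 0] both are [fib n.+1]. *)
Lemma fib_addS m n :
  fib (m + n).+1 = (fib m.+1 * fib n.+1 + fib m * fib n)%N.
Proof.
elim: m n => [|m IHm] n; first by rewrite mul1n mul0n addn0.
rewrite addSnnS IHm !fibSS; ring.
Qed.

Lemma fib_double_succ n : fib (2 * n + 1) = (fib n ^ 2 + fib n.+1 ^ 2)%N.
Proof. by rewrite addn1 mul2n -addnn fib_addS addnC. Qed.

Lemma sum_sqr_fib_window (n : nat) :
  (fib n ^ 2 + fib (n + 3) ^ 2 + 2 * fib (n + 1) ^ 2 + 2 * fib (n + 2) ^ 2
   = 4 * fib (2 * n + 3))%N.
Proof.
have -> : (2 * n + 3 = 2 * n.+1 + 1)%N by ring.
rewrite fib_double_succ addn1 addn2 addn3 !fibSS; ring.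
Qed.

(** The coordinates are halves, so four times the norm is the norm form
    evaluated at the integers [fib (wapp s _)]. *)
Lemma qnorm_FibHurwitz n (s : {perm window n}) :
  4 * qnorm (FibHurwitz s) =
  (fib (wapp s n) ^ 2 + fib (wapp s (n + 1)) ^ 2
   + 2 * fib (wapp s (n + 2)) ^ 2 + 2 * fib (wapp s (n + 3)) ^ 2)%:R.
Proof.
have four_halves (x : Qi) : 4 * (2^-1 * x) ^+ 2 = x ^+ 2.
  have two_neq0 : 2 != 0 :> Qi by [].
  by field.
rewrite /FibHurwitz quat_coords /qnorm /= !mulrDr.
by rewrite !(mulrCA 4 2) !four_halves !(natrD, natrX, natrM).
Qed.

Theorem proposition5p1 (n : nat) (n_gt0 : (0 < n)%N) (s : {perm window n}) :
  [\/ two_row s [:: n + 3; n; n + 1; n + 2]%N,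
      two_row s [:: n; n + 3; n + 1; n + 2]%N,
      two_row s [:: n + 3; n; n + 2; n + 1]%N
    | two_row s [:: n; n + 3; n + 2; n + 1]%N] ->
  qnorm (FibHurwitz s) = (fib (2 * n + 3))%:R.
Proof.
have four_neq0 : 4 != 0 :> Qi by [].
move=> rows; apply: (mulfI four_neq0).
rewrite qnorm_FibHurwitz -natrM -sum_sqr_fib_window; congr (_%:R).
by case: rows => -[-> -> -> ->]; ring.
Qed.
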